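(* Let $n, D, N$ be positive integers with $1\le n\le \min\{D,N-D\}$, let $Y_1,\dots,Y_n$ be a sample drawn without replacement from an urn with $N$ balls of which $D$ are labeled $1$ and $N-D$ are labeled $0$, and let $\overline Y_n=n^{-1}\sum_{i=1}^n Y_i$ (so that $n\overline Y_n$ has the Hypergeometric$(n,D,N)$ distribution). Put $\mu_N=D/N$, $\sigma_N^2=\mu_N(1-\mu_N)$ and $1-f_n=1-\frac{n-1}{N-1}$. Then for all $\lambda>0$, $$P\left(\sqrt n(\overline Y_n-\mu_N)\ge\lambda\right)\le \exp\left(-\frac{\lambda^2}{2\sigma_N^2(1-f_n)}\,\psi\left(\frac{\lambda}{\sqrt n\,\sigma_N^2(1-f_n)}\right)\right),$$ where $\psi(y)=2y^{-2}h(1+y)$ for $y>0$ and $h(y)=y(\log y-1)+1$.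
   Context: The Hypergeometric$(n,D,N)$ distribution is given by $P\left(\sum_{i=1}^n Y_i=k\right)=\binom{D}{k}\binom{N-D}{n-k}/\binom{N}{n}$ for $\max\{0,D+n-N\}\le k\le\min\{n,D\}$. *)

(* Defs.v *)
From HB Require Import structures.
From mathcomp Require Import all_boot all_order all_algebra.
From mathcomp Require Import all_classical all_reals all_analysis.

Set Implicit Arguments.
Unset Strict Implicit.
Unset Printing Implicit Defensive.

Import Order.TTheory GRing.Theory Num.Theory.
Import numFieldNormedType.Exports.

Local Open Scope ring_scope.

(* The ordered samples of n distinct balls from an urn whose N balls are the
   elements of 'I_N. *)
Definition ordered_samples (n N : nat) : {set {ffun 'I_n -> 'I_N}} :=
  [set x : {ffun 'I_n -> 'I_N} | injectiveb x].

(* A is the set of balls labeled 1, the others being labeled 0. The joint law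
   of (Y_1, ..., Y_n) is that of the labels of the successively drawn balls
   when all ordered samples are equally likely. These probabilities sum to 1
   over y, so the Y i are almost surely 0/1-valued; since only the law is
   constrained, the balls drawn need not be random variables on T. *)
Definition sample_without_replacement (R : realType) (d : measure_display)
    (T : measurableType d) (P : probability T R) (n N : nat)
    (A : {set 'I_N}) (Y : 'I_n -> {RV P >-> R}) : Prop :=
  forall y : {ffun 'I_n -> bool},
    P [set t : T | forall i : 'I_n, Y i t = (y i)%:R]%classic =
    (#|[set x in ordered_samples n N | [forall i, (x i \in A) == y i]]|%:R
      / #|ordered_samples n N|%:R)%:E.

Definition sample_mean (R : realType) (d : measure_display)
    (T : measurableType d) (P : probability T R) (n : nat)
    (Y : 'I_n -> {RV P >-> R}) (t : T) : R :=
  n%:R^-1 * \sum_(i < n) Y i t.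

Definition urn_mean (R : realType) (D N : nat) : R := D%:R / N%:R.

Definition urn_variance (R : realType) (D N : nat) : R :=
  urn_mean R D N * (1 - urn_mean R D N).

(* f_n, so that 1 - f_n is the finite-population correction. *)
Definition sampling_fraction (R : realType) (n N : nat) : R :=
  (n%:R - 1) / (N%:R - 1).

Definition bennett_h (R : realType) (y : R) : R := y * (ln y - 1) + 1.

(* Used only at y > 0. *)
Definition bennett_psi (R : realType) (y : R) : R :=
  2 * y ^- 2 * bennett_h (1 + y).

(* Main.v *)
Require Import Defs.
From HB Require Import structures.
From mathcomp Require Import all_boot all_order all_algebra.
From mathcomp Require Import ring lra zify.
From mathcomp Require Import all_classical all_reals all_analysis.

(** The deviation of the sum S of the labels is bounded by Chernoff's method,
through a bound on the generating function of the hypergeometric law that has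
the same form as for a sum of independent 0/1 variables with the same variance.

Write m and V for the mean and variance of S. For z = 1 + s >= 1, the claim is
[E z^S <= z^(m - V) exp (V (z - 1))], that is, Bennett's bound
[E exp (theta (S - m)) <= exp (V (exp theta - 1 - theta))] with z = exp theta.
It is usually deduced from the fact that S has the law of a sum of independent
Bernoulli variables, which rests on the real-rootedness of the generating
function. The route taken here is more elementary. In powers of s, the function
G(s) = E (1 + s)^S has the explicit coefficients
[C(D, j) C(N - j, n - j) / C(N, n)] (sum_subsets_hypergeo_poly), whose
consecutive ratios are rational in j (hypergeo_poly_coef_rec). With them one
checks, coefficient by coefficient, the differential inequality
[(1 + s) G'(s) <= (m + V s) G(s)] (hypergeo_poly_deriv_le), and integrating it
from 0 gives the claim (horner_le_expR).

Markov's inequality then bounds the tail at m + t by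
[exp (V s - (V + t) ln (1 + s))] (subset_tail_le_expR), and s = t / V, where
t = sqrt n * lambda, turns this into [exp (- V h (1 + t / V))], which is the
bound stated in terms of psi. The tail probability itself is at most a
proportion of ordered samples (prob_sample_sum_ge), which equals a proportion of
n-subsets (ordered_tail_subsets). *)

Set Implicit Arguments.
Unset Strict Implicit.
Unset Printing Implicit Defensive.

Import Order.TTheory GRing.Theory Num.Theory.
Import numFieldNormedType.Exports.

Local Open Scope ring_scope.

(** * Generating function of the number of labeled balls in a subset *)

(** Expanding the product chooses a set of balls B; the power of the variable
records #|B|, and each ball of A in B contributes a factor 1 + s. *)
Lemma sum_subsets_coef_prod (R : comNzRingType) (T : finType) (A : {set T})
    (n : nat) (s : R) :
  \sum_(B : {set T} | #|B| == n) (1 + s) ^+ #|B :&: A| =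
  (\prod_(b : T) ((if b \in A then 1 + s else 1)%:P * 'X + 1))`_n.
Proof.
rewrite bigA_distr coef_sum [RHS](bigID (fun B : {set T} => #|B| == n)) /=.
rewrite [X in _ = _ + X]big1 ?addr0; last first.
  move=> B nB; rewrite -big_mkcond /= big_split /= prodr_const -rmorph_prod /=.
  by rewrite coefCM coefXn eq_sym (negbTE nB) mulr0.
apply: eq_bigr => B /eqP nB.
rewrite -big_mkcond /= big_split /= prodr_const -rmorph_prod /=.
rewrite coefCM coefXn nB eqxx mulr1 -big_mkcondr /=.
rewrite prodr_const; congr (_ ^+ _).
by apply: eq_card => b; rewrite !inE.
Qed.

(** On the balls of A the factor is split as ('X + 1) + s *: 'X, so that the
binomial theorem sorts the product by powers of s rather than of 1 + s. *)
Lemma prod_ball_factors (R : comNzRingType) (T : finType) (A : {set T})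
    (s : R) :
  \prod_(b : T) ((if b \in A then 1 + s else 1)%:P * 'X + 1) =
  \sum_(j < #|A|.+1)
    s ^+ j *: ('X^j * ('X + 1) ^+ (#|T| - j)) *+ 'C(#|A|, j).
Proof.
rewrite (bigID (mem A)) /=.
rewrite (eq_bigr (fun _ => ('X + 1) + s *: 'X)); last first.
  by move=> b ->; rewrite -mul_polyC; rewrite polyCD; ring.
rewrite prodr_const [X in _ * X](eq_bigr (fun _ => 'X + 1)); last first.
  by move=> b /negbTE ->; ring.
rewrite prodr_const exprDn mulr_suml; apply: eq_bigr => j _.
have jA : (j <= #|A|)%N by rewrite -ltnS.
have -> : #|[predC A]| = (#|T| - #|A|)%N by rewrite -(cardC A) addKn.
have -> : (#|T| - j = (#|A| - j) + (#|T| - #|A|))%N.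
  by have AT : (#|A| <= #|T|)%N := max_card (mem A); lia.
by rewrite exprZn exprD mulrnAl -scalerAr -scalerAl; congr (_ *: _ *+ _); ring.
Qed.

Lemma coef_XaddC1_exp (R : comNzRingType) (m k : nat) :
  (('X + 1) ^+ m : {poly R})`_k = 'C(m, k)%:R.
Proof.
elim: m k => [|m IH] [|k]; rewrite ?expr0 ?coef1 ?bin0 //.
  by rewrite exprSr mulrDr mulr1 coefD coefMX IH bin0 add0r.
by rewrite exprSr mulrDr mulr1 coefD coefMX !IH binS natrD addrC.
Qed.

(** For a uniform n-subset of N balls, D of them labeled 1, this polynomial at s
is 'C(N, n) times the mean of (1 + s) ^+ S, where S is the number of 1s drawn:
its coefficients are 'C(N, n) times the means of the binomials of S over j.
The sum stops at n because 'C(N - j, n - j) is 1 for j > n, where the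
truncated difference n - j is 0. *)
Definition hypergeo_poly (R : comNzRingType) (n D N : nat) : {poly R} :=
  \poly_(j < n.+1) ('C(D, j) * 'C(N - j, n - j))%:R.

Lemma sum_subsets_hypergeo_poly (R : comNzRingType) (T : finType)
    (A : {set T}) (n : nat) (s : R) :
  \sum_(B : {set T} | #|B| == n) (1 + s) ^+ #|B :&: A| =
  (hypergeo_poly R n #|A| #|T|).[s].
Proof.
rewrite sum_subsets_coef_prod prod_ball_factors coef_sum horner_poly.
(* The two sums over j run up to #|A| and up to n; both are sums of F, which
   vanishes outside the common range. *)
pose F (j : nat) : R :=
  (if (j <= n)%N then 'C(#|A|, j) * 'C(#|T| - j, n - j) else 0)%N%:R * s ^+ j.
rewrite (eq_bigr (fun j : 'I_#|A|.+1 => F j)); last first.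
  move=> j _; rewrite /F coefMn coefZ coefXnM coef_XaddC1_exp ltnNge.
  by case: leqP => _ /=; rewrite ?natrM -mulr_natr; ring.
rewrite [RHS](eq_bigr (fun j : 'I_n.+1 => F j)); last first.
  by move=> j _; rewrite /F -ltnS ltn_ord.
rewrite (big_ord_widen (n.+1 + #|A|.+1)) ?leq_addl //.
rewrite [RHS](big_ord_widen (n.+1 + #|A|.+1)) ?leq_addr //.
rewrite big_mkcond [RHS]big_mkcond; apply: eq_bigr => j _.
rewrite !ltnS /F; case: (leqP j n) => jn; case: (leqP j #|A|) => jA //.
- by rewrite (bin_small jA) mul0n mul0r.
- by rewrite mul0r.
Qed.

(** In terms of a j = 'C(D, j) * 'C(N - j, n - j), the ratio a j.+1 / a j is
(D - j) (n - j) / (j.+1 (N - j)); beyond degree n both sides vanish. *)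
Lemma hypergeo_poly_coef_rec (R : comNzRingType) (n D N j : nat) : (n <= N)%N ->
  j.+1%:R * (N%:R - j%:R) * (hypergeo_poly R n D N)`_j.+1 =
  (D%:R - j%:R) * (n%:R - j%:R) * (hypergeo_poly R n D N)`_j.
Proof.
move=> nN; rewrite !coef_poly !ltnS.
case: (ltngtP j n) => [jn|jn|->];
  rewrite ?(ltnW jn) ?mulr0 ?subrr ?mulr0 ?mul0r //.
have hC : j.+1%:R * 'C(D, j.+1)%:R = (D%:R - j%:R) * 'C(D, j)%:R :> R.
  case: (leqP j D) => jD; first by rewrite -natrB // -!natrM mul_bin_left.
  by rewrite (bin_small jD) bin_small ?mulr0 // ltnW.
have hN : (N%:R - j%:R) * 'C(N - j.+1, n - j.+1)%:R =
    (n%:R - j%:R) * 'C(N - j, n - j)%:R :> R.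
  rewrite -!natrB ?(ltnW jn) ?(leq_trans (ltnW jn)) // -!natrM; congr _%:R.
  have := mul_bin_diag (N - j) (n - j.+1).
  by rewrite -subnS subnSK.
rewrite !natrM.
transitivity ((j.+1%:R * 'C(D, j.+1)%:R) *
  ((N%:R - j%:R) * 'C(N - j.+1, n - j.+1)%:R) : R); first by ring.
by rewrite hC hN; ring.
Qed.

(** * Differential inequality for the generating function *)

Definition sum_mean (R : realType) (n D N : nat) : R := n%:R * urn_mean R D N.

Definition sum_variance (R : realType) (n D N : nat) : R :=
  n%:R * urn_variance R D N * (1 - sampling_fraction R n N).

(** With G the generating function of the number of 1s in the variable
z = 1 + s, z G' / G is the mean of the law tilted by z, whose derivative in
ln z is the variance of that law. The bound m + V (z - 1) on the mean is the
one that a bound V z on the variance would give by integration.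

The inequality holds coefficient by coefficient in s. In degree 0 it is an
equality. In degree i + 1 with i < n, the recurrence for the coefficients
reduces it to (n - i) (D - i) N (N - 1) <= n D (N - i) (N - i - 1), the product
of N (n - i) <= n (N - i) and (N - 1) (D - i) <= D (N - 1 - i). In higher
degrees only the term V G`_i remains, which is nonnegative. *)
Lemma hypergeo_poly_deriv_le (R : realType) (n D N : nat) (s : R) :
  (0 < n < N)%N -> (D < N)%N -> 0 <= s ->
  (1 + s) * (hypergeo_poly R n D N)^`().[s] <=
    (sum_mean R n D N + sum_variance R n D N * s) * (hypergeo_poly R n D N).[s].
Proof.
move=> /andP[n0 nN] DN s0.
set G := hypergeo_poly _ _ _ _.
set m := sum_mean _ _ _ _; set V := sum_variance _ _ _ _.
have g0 j : 0 <= G`_j by rewrite coef_poly; case: ifP.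
have N0 : 0 < N%:R :> R by rewrite ltr0n; lia.
have n1' : 1 <= n%:R :> R by rewrite ler1n.
have nN' : n%:R + 1 <= N%:R :> R by rewrite natr1 ler_nat.
have D0' : 0 <= D%:R :> R by rewrite ler0n.
have DN' : D%:R + 1 <= N%:R :> R by rewrite natr1 ler_nat.
have N1 : 0 < N%:R - 1 :> R by lra.
have VE : V = n%:R * D%:R * (N%:R - n%:R) * (N%:R - D%:R) /
    (N%:R ^+ 2 * (N%:R - 1)).
  rewrite /V /sum_variance /urn_variance /urn_mean /sampling_fraction; field.
  by rewrite !gt_eqF.
suff h j : 0 <= ((m%:P + V%:P * 'X) * G - (1 + 'X) * G^`())`_j.
  rewrite -subr_ge0.
  suff -> : (m + V * s) * G.[s] - (1 + s) * G^`().[s] =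
     ((m%:P + V%:P * 'X) * G - (1 + 'X) * G^`()).[s].
    by rewrite horner_coef; apply: sumr_ge0 => i _; rewrite mulr_ge0 ?exprn_ge0.
  by rewrite !hornerE.
rewrite coefB !mulrDl mul1r !coefD -mulrA !coefCM !coefXM !coef_deriv.
have rec k : k.+1%:R * (N%:R - k%:R) * G`_k.+1 =
    (D%:R - k%:R) * (n%:R - k%:R) * G`_k.
  by apply: hypergeo_poly_coef_rec; exact: ltnW.
case: j => [|i] /=.
  have := rec 0%N; rewrite !subr0 mulr0 !addr0 mulr1n mul1r => r0.
  suff -> : G`_1 = m * G`_0 by rewrite subrr.
  apply: (mulfI (lt0r_neq0 N0)); rewrite r0 /m /sum_mean /urn_mean; field.
  by rewrite gt_eqF.
have V0 : 0 <= V.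
  by rewrite VE; apply: divr_ge0; rewrite ?mulr_ge0 ?exprn_ge0 //; lra.
have [ni|iN] := leqP n i.
  have z k : (n <= k)%N -> G`_k.+1 = 0.
    by move=> nk; rewrite coef_poly ltnS ltnNge nk.
  by rewrite (z _ ni) (z _ (leqW ni)) !mul0rn !mulr0 !add0r subr0 mulr_ge0.
have r1 := rec i; have r2 := rec i.+1; have c0 := g0 i.
have i0' : 0 <= i%:R :> R by rewrite ler0n.
have in' : i%:R + 1 <= n%:R :> R by rewrite natr1 ler_nat.
have Ni : 0 < N%:R - i%:R :> R by lra.
have Ni1 : 0 < N%:R - i%:R - 1 :> R by lra.
(* The recurrence expresses both coefficients that occur through G`_i. *)
have bE : G`_i.+1 = (D%:R - i%:R) * (n%:R - i%:R) * G`_i /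
    ((i%:R + 1) * (N%:R - i%:R)).
  apply: (canRL (mulfK _)); last by rewrite -r1 -(natr1 i); ring.
  by rewrite mulf_neq0 ?gt_eqF //; lra.
have eE : G`_i.+2 *+ i.+2 =
    (D%:R - i%:R - 1) * (n%:R - i%:R - 1) * G`_i.+1 / (N%:R - i%:R - 1).
  apply: (canRL (mulfK _)); first by rewrite gt_eqF.
  have -> : (D%:R - i%:R - 1) * (n%:R - i%:R - 1) * G`_i.+1 =
    (D%:R - i.+1%:R) * (n%:R - i.+1%:R) * G`_i.+1 by rewrite -(natr1 i); ring.
  by rewrite -r2 -mulr_natr -!(natr1 i.+1) -(natr1 i); ring.
rewrite eE -(mulr_natr G`_i.+1) bE -(natr1 i) VE /m /sum_mean /urn_mean.
(* Up to a nonnegative factor the coefficient is G`_i * (p * u - q * v), and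
   p * u - q * v = (p - q) * u + q * (u - v). *)
set p := n%:R * (N%:R - i%:R) : R; set q := N%:R * (n%:R - i%:R) : R.
set u := D%:R * (N%:R - 1 - i%:R) : R; set v := (D%:R - i%:R) * (N%:R - 1) : R.
have pq : 0 <= p - q.
  have -> : p - q = i%:R * (N%:R - n%:R) by rewrite /p /q; ring.
  by rewrite mulr_ge0 //; lra.
have uv : 0 <= u - v.
  have -> : u - v = i%:R * (N%:R - 1 - D%:R) by rewrite /u /v; ring.
  by rewrite mulr_ge0 //; lra.
have q0 : 0 <= q by rewrite mulr_ge0 //; lra.
have u0 : 0 <= u by rewrite mulr_ge0 //; lra.
have b0 : 0 <= (p - q) * u + q * (u - v) by apply: addr_ge0; exact: mulr_ge0.
rewrite [leRHS](_ : _ = G`_i * ((N%:R - n%:R) * (N%:R - D%:R)) *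
    ((p - q) * u + q * (u - v)) /
    (N%:R ^+ 2 * (N%:R - 1) * (N%:R - i%:R) * (N%:R - i%:R - 1))); last first.
  rewrite /p /q /u /v; field; rewrite !gt_eqF //; lra.
apply: divr_ge0; first by rewrite !mulr_ge0 //; lra.
by rewrite !mulr_ge0 ?sqr_ge0 //; lra.
Qed.

(** The hypothesis bounds p^`().[u] by ((m - V) / (1 + u) + V) * p.[u], whose
first factor is the derivative of (m - V) * ln (1 + u) + V * u; hence p divided
by the exponential of the latter is nonincreasing. *)
Lemma horner_le_expR (R : realType) (p : {poly R}) (m V s : R) : 0 <= s ->
  (forall u : R, 0 <= u -> (1 + u) * p^`().[u] <= (m + V * u) * p.[u]) ->
  p.[s] <= p.[0] * expR ((m - V) * ln (1 + s) + V * s).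
Proof.
move=> s0 H.
pose g u : R := (m - V) * ln (1 + u) + V * u.
pose f u : R := p.[u] * expR (- g u).
have df (u : R) : 0 <= u -> is_derive u 1 f
    ((p^`().[u] - ((m - V) / (1 + u) + V) * p.[u]) * expR (- g u)).
  move=> u0.
  have u1 : 0 < 1 + u by lra.
  have dln : is_derive u 1 (fun v : R => ln (1 + v)) (1 + u)^-1.
    have d1 : is_derive u 1 (fun v : R => 1 + v) 1.
      by apply: is_derive_eq; rewrite add0r mulr1.
    have := is_derive1_comp (f := @ln R) (g := fun v : R => 1 + v)
      (is_derive1_ln u1) d1.
    by rewrite mulr1.
  have dg : is_derive u 1 (fun v => - g v) (- ((m - V) / (1 + u) + V)).
    rewrite /g; apply: is_derive_eq; rewrite /GRing.scale /=; ring.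
  have de := is_derive1_comp (g := fun v => - g v) (is_derive_expR (- g u)) dg.
  have dp : is_derive u 1 (fun v => p.[v]) p^`().[u].
    exact: is_derive_poly.
  have dpe := @is_deriveM _ _ _ _ u 1 _ _ dp de.
  rewrite /f; apply: is_derive_eq; rewrite /GRing.scale /=; ring.
have fs0 : f s <= f 0.
  apply: (@ler0_derive1_nincry R f 0) => //.
  - by move=> u; rewrite in_itv/= andbT => /ltW u0; case: (df u u0).
  - move=> u; rewrite in_itv/= andbT => /ltW u0; rewrite derive1E.
    case: (df u u0) => _ ->.
    rewrite pmulr_lle0 ?expR_gt0 // subr_le0.
    have u1 : 0 < 1 + u by lra.
    rewrite -(ler_pM2l u1); apply: le_trans (H u u0) _.
    rewrite le_eqVlt; apply/orP; left; apply/eqP; field.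
    by rewrite gt_eqF.
  - apply: derivable_within_continuous => u.
    by rewrite in_itv/= andbT => u0; case: (df u u0).
move: fs0; rewrite /f /g addr0 ln1 !mulr0 addr0 oppr0 expR0 mulr1.
by rewrite expRN ler_pdivrMr ?expR_gt0.
Qed.

(** * Exponential tail bound for uniform subsets *)

(** Chernoff's bound: on the event, (1 + s) ^+ #|B :&: A| is at least the power
of 1 + s with exponent a, and its mean over n-subsets is bounded by
hypergeo_poly_deriv_le through horner_le_expR. *)
Lemma subset_tail_le_expR (R : realType) (T : finType) (A : {set T})
    (n : nat) (a s : R) :
  (0 < n < #|T|)%N -> (#|A| < #|T|)%N -> 0 <= s ->
  (\sum_(B : {set T} | (#|B| == n) && (a <= #|B :&: A|%:R)) 1) /
      'C(#|T|, n)%:R <=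
  expR ((sum_mean R n #|A| #|T| - sum_variance R n #|A| #|T| - a) *
      ln (1 + s) +
    sum_variance R n #|A| #|T| * s).
Proof.
move=> nT AT s0.
have s1 : 0 < 1 + s by lra.
have C0 : 0 < 'C(#|T|, n)%:R :> R.
  by rewrite ltr0n bin_gt0 ltnW //; case/andP: nT.
set m := sum_mean _ _ _ _; set V := sum_variance _ _ _ _.
rewrite ler_pdivrMr // mulrBl addrAC expRD expRN -mulrAC.
rewrite ler_pdivlMr ?expR_gt0 // mulrC.
have := horner_le_expR s0
  (fun u u0 => hypergeo_poly_deriv_le (R := R) nT AT u0).
rewrite -/m -/V horner_coef0 coef_poly /= bin0 mul1n !subn0 mulrC.
apply: le_trans; rewrite -sum_subsets_hypergeo_poly mulr_sumr.
rewrite [leRHS](bigID (fun B : {set T} => a <= #|B :&: A|%:R)) /=.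
apply: ler_wpDr; first by apply: sumr_ge0 => B _; rewrite exprn_ge0 // ltW.
apply: ler_sum => B /andP[_ aB].
rewrite mulr1 -[leRHS]lnK ?posrE ?exprn_gt0 // lnXn // ler_expR -mulr_natl.
by rewrite ler_wpM2r // ln_ge0 // lerDl.
Qed.

(** * From random labels to subsets *)

(** Each n-subset is the set of balls of n`! ordered samples. *)
Lemma sum_ordered_samples (R : nzRingType) (n N : nat) (F : {set 'I_N} -> R) :
  \sum_(x in ordered_samples n N) F [set x i | i : 'I_n] =
  n`!%:R * \sum_(B : {set 'I_N} | #|B| == n) F B.
Proof.
rewrite (partition_big (fun x : {ffun 'I_n -> 'I_N} => [set x i | i : 'I_n])
  (fun B => #|B| == n)) /=; last first.
  by move=> x; rewrite inE => /injectiveP xi; rewrite card_imset ?card_ord.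
rewrite mulr_sumr; apply: eq_bigr => B /eqP Bn.
rewrite (eq_bigr (fun _ => F B)) => [|x /andP[_ /eqP-> //]].
rewrite sumr_const mulr_natl; congr (_ *+ _).
transitivity
  #|[set f in ffun_on B | injectiveb (f : {ffun 'I_n -> 'I_N})]|; last first.
  by rewrite card_inj_ffuns_on Bn card_ord ffactnn.
apply: eq_card => x; rewrite [LHS]unfold_in !inE [RHS]andbC.
apply: andb_id2l => /injectiveP xi.
apply/eqP/forallP => [<- i|xB]; first by rewrite imset_f.
apply/eqP; rewrite eqEcard card_imset // Bn card_ord leqnn andbT.
by apply/fintype.subsetP => _ /imsetP[i _ ->].
Qed.

Lemma ordered_tail_subsets (R : realFieldType) (n N : nat) (A : {set 'I_N})
    (a : R) : (n <= N)%N ->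
  #|[set x in ordered_samples n N | a <= #|[set i | x i \in A]|%:R]|%:R /
    #|ordered_samples n N|%:R =
  (\sum_(B : {set 'I_N} | (#|B| == n) && (a <= #|B :&: A|%:R)) 1) /
    'C(N, n)%:R :> R.
Proof.
move=> nN.
have -> : #|ordered_samples n N| = ('C(N, n) * n`!)%N.
  by rewrite bin_ffact card_inj_ffuns !card_ord.
rewrite -sum1_card natr_sum.
rewrite (eq_bigl (fun x : {ffun 'I_n -> 'I_N} =>
  (x \in ordered_samples n N) &&
  (a <= #|[set i | x i \in A]|%:R))); last first.
  by move=> x; rewrite inE.
pose F (B : {set 'I_N}) : R := if a <= #|B :&: A|%:R then 1 else 0.
rewrite big_mkcondr /= (eq_bigr (fun x : {ffun 'I_n -> 'I_N} =>
  F [set x i | i : 'I_n])); last first.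
  move=> x; rewrite inE => /injectiveP xi; rewrite /F.
  congr (if a <= _%:R then _ else _).
  rewrite -(card_imset _ xi); apply: eq_card => b; rewrite inE.
  apply/imsetP/andP => [[i]|[/imsetP[i _ ->] iA]]; last first.
    by exists i; rewrite ?inE.
  by rewrite inE => iA ->; rewrite imset_f.
rewrite sum_ordered_samples /F -big_mkcondr /= natrM; field.
by rewrite !pnatr_eq0 -!lt0n fact_gt0 bin_gt0 nN.
Qed.

(** Bounding the complement avoids any discussion of the null set on which the
Y i are not all 0 or 1: the disjoint events that (Y_1, ..., Y_n) is a given 0/1
pattern y with sum less than a have total probability the proportion of
ordered samples with fewer than a ones, and all of them miss the event. *)
Lemma prob_sample_sum_ge (R : realType) (d : measure_display)
    (T : measurableType d) (P : probability T R) (n N : nat) (A : {set 'I_N})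
    (Y : 'I_n -> {RV P >-> R}) (a : R) :
  (n <= N)%N -> sample_without_replacement A Y ->
  (P [set t : T | (a <= \sum_(i < n) Y i t)%R]%classic <=
   (#|[set x in ordered_samples n N | a <= #|[set i | x i \in A]|%:R]|%:R
      / #|ordered_samples n N|%:R)%:E)%E.
Proof.
move=> nN hY.
pose E (y : {ffun 'I_n -> bool}) :=
  [set t : T | forall i, Y i t = (y i)%:R]%classic.
pose S (y : {ffun 'I_n -> bool}) : R := \sum_i (y i)%:R.
have mE y : measurable (E y).
  rewrite (_ : E y =
    \bigcap_(i in [set: 'I_n]) (Y i @^-1` [set (y i)%:R]))%classic; last first.
    by apply/seteqP; split => t /= h i; [move=> _; exact: h|exact: h].
  exact: fin_bigcap_measurable.
have tE : trivIset [set y | S y < a]%classic E.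
  move=> y y' _ _ [t [Et Et']]; apply/ffunP => i.
  have : (y i)%:R = (y' i)%:R :> R by rewrite -Et -Et'.
  by move/eqP; rewrite eqr_nat; case: (y i); case: (y' i).
pose U := (\bigcup_(y in [set y | S y < a]) E y)%classic.
have mU : measurable U by apply: fin_bigcup_measurable.
have mB : measurable [set t : T | a <= \sum_(i < n) Y i t]%classic.
  have mS : measurable_fun setT (fun t => \sum_(i < n) Y i t).
    by apply: measurable_sum => i; exact: measurable_funPT.
  have := mS measurableT _ (measurable_itv `[a, +oo[).
  rewrite setTI; congr (measurable _); apply/seteqP; split => t /=;
    by rewrite in_itv/= andbT.
pose M : R := #|ordered_samples n N|%:R.
have M0 : 0 < M by rewrite ltr0n card_inj_ffuns !card_ord ffact_gt0.
have PU : P U = (#|[set x in ordered_samples n N |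
    #|[set i | x i \in A]|%:R < a]|%:R / M)%:E.
  rewrite measure_fin_bigcup //; last exact: finite_finset.
  rewrite -(bigfs _ (r := enum {ffun 'I_n -> bool}) (P := fun y => S y < a))
    ?enum_uniq //; last first.
    by move=> y _; rewrite mem_enum.
  rewrite big_enum_cond /=.
  under eq_bigr do rewrite hY.
  rewrite sumEFin -mulr_suml -natr_sum; congr (_%:R / _)%:E.
  pose h (x : {ffun 'I_n -> 'I_N}) := [ffun i => x i \in A].
  have Sh x : S (h x) = #|[set i | x i \in A]|%:R.
    rewrite -sum1_card natr_sum [RHS]big_mkcond /=.
    by apply: eq_bigr => i _; rewrite ffunE inE; case: (x i \in A).
  rewrite -[RHS]sum1_card (partition_big h (fun y => S y < a)) /=; last first.
    by move=> x; rewrite !inE Sh => /andP[].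
  apply: eq_bigr => y ya; rewrite -sum1_card; apply: eq_bigl => x; rewrite !inE.
  rewrite -andbA; congr (_ && _).
  have <- : (h x == y) = [forall i, (x i \in A) == y i].
    apply/eqP/forallP => [<- i|hx]; first by rewrite ffunE.
    by apply/ffunP => i; rewrite ffunE; apply/eqP.
  by case: eqP => [hx|]; rewrite ?andbF // andbT -Sh hx ya.
have PB : (P [set t : T | (a <= \sum_(i < n) Y i t)%R]%classic <=
    P (~` U)%classic)%E.
  apply: le_measure; rewrite ?inE //; first exact: measurableC.
  move=> t /= at_ [y /= ya Et]; move: at_.
  by rewrite (eq_bigr (fun i => (y i)%:R)) // leNgt -/(S y) ya.
apply: (le_trans PB); rewrite probability_setC // PU -EFinB lee_fin.
rewrite ler_pdivlMr // mulrBl mul1r divfK ?gt_eqF // lerBlDr -natrD ler_nat.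
rewrite -(cardsID [set x : {ffun 'I_n -> 'I_N} |
  a <= #|[set i | x i \in A]|%:R]).
rewrite leq_add //; apply: subset_leq_card; apply/fintype.subsetP => x.
  by rewrite !inE.
by rewrite !inE -ltNge andbC.
Qed.

(** * Tail bound for the sample mean *)

Theorem corollary1 (R : realType) (d : measure_display)
    (T : measurableType d) (P : probability T R)
    (n D N : nat) (hD : (0 < D)%N) (hN : (0 < N)%N)
    (hn : (1 <= n <= minn D (N - D))%N)
    (A : {set 'I_N}) (hA : #|A| = D)
    (Y : 'I_n -> {RV P >-> R}) (hY : sample_without_replacement A Y)
    (lambda : R) (hlambda : 0 < lambda) :
  let mu := urn_mean R D N in
  let sigma2 := urn_variance R D N in
  let f := sampling_fraction R n N in
  (P [set t : T | (Num.sqrt n%:R * (sample_mean Y t - mu) >= lambda)%R]%classic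
   <= (expR (- (lambda ^+ 2 / (2 * sigma2 * (1 - f)))
             * bennett_psi (lambda / (Num.sqrt n%:R * sigma2 * (1 - f)))))%:E)%E.
Proof.
cbv zeta; set mu := urn_mean R D N; set sigma2 := urn_variance R D N.
set f := sampling_fraction R n N.
have [n0 nD nND] : [/\ 0 < n, n <= D & n <= N - D]%N.
  by move: hn; rewrite leq_min => /and3P[].
have nN : (n < N)%N by lia.
have DN : (D < N)%N by lia.
pose r : R := Num.sqrt n%:R.
have r0 : 0 < r by rewrite sqrtr_gt0 ltr0n.
have rE : n%:R = r ^+ 2 :> R by rewrite sqr_sqrtr.
pose a : R := n%:R * mu + r * lambda.
have -> : [set t : T |
      Num.sqrt n%:R * (sample_mean Y t - mu) >= lambda]%classic =
    [set t : T | a <= \sum_(i < n) Y i t]%classic.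
  apply/seteqP; suff h t : (lambda <= Num.sqrt n%:R * (sample_mean Y t - mu)) =
      (a <= \sum_(i < n) Y i t).
    by split => t /=; rewrite h.
  rewrite -/r -(ler_pM2l r0) mulrA -expr2 -rE mulrBr /sample_mean mulrA.
  rewrite divff ?mul1r.
    by rewrite lerBrDl.
  by rewrite pnatr_eq0 -lt0n.
apply: (le_trans (prob_sample_sum_ge a (ltnW nN) hY)).
rewrite lee_fin ordered_tail_subsets ?(ltnW nN) //.
pose w : R := sigma2 * (1 - f).
have w0 : 0 < w.
  have n0' : 0 < n%:R :> R by rewrite ltr0n.
  have D0' : 0 < D%:R :> R by rewrite ltr0n.
  have nN' : n%:R + 1 <= N%:R :> R by rewrite natr1 ler_nat.
  have DN' : D%:R + 1 <= N%:R :> R by rewrite natr1 ler_nat.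
  rewrite /w /sigma2 /urn_variance /urn_mean /f /sampling_fraction.
  apply: mulr_gt0; first apply: mulr_gt0.
  - by rewrite divr_gt0 //; lra.
  - by rewrite subr_gt0 ltr_pdivrMr; lra.
  - by rewrite subr_gt0 ltr_pdivrMr; lra.
have VE : sum_variance R n D N = r ^+ 2 * w.
  by rewrite /sum_variance -rE /w mulrA.
pose y := lambda / (r * w).
have y0 : 0 < y by rewrite divr_gt0 // mulr_gt0.
(* y = t / V, with t = r * lambda the deviation of the sum and V its variance,
   is the s that minimizes the exponent in subset_tail_le_expR. *)
have := subset_tail_le_expR (R := R) (T := 'I_N) (A := A) (n := n) a (s := y).
rewrite card_ord hA n0 nN DN => /(_ isT isT (ltW y0)) /le_trans; apply.
rewrite ler_expR VE.
rewrite -/r -2![_ * sigma2 * _]mulrA -/w -/y /bennett_psi /bennett_h.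
rewrite le_eqVlt; apply/orP; left; apply/eqP.
rewrite /sum_mean -/mu /a.
set L := ln _; rewrite /y; field.
by rewrite !gt_eqF.
Qed.
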